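(* Let $\mathcal F\in\mathcal H(d)$ and let $T$ be the unique positive harmonic current of mass one directed by $\mathcal F$. The metric $g_T$ associated to $T$ on the leaves of $\mathcal F$ (defined for $\|T\|$-almost every leaf) has constant negative curvature out of the set $\mathcal C_T$ where the metric vanishes.
   Context: A holomorphic foliation of $\mathbb P^2$ of degree $d$ is given by a homogeneous 1-form $\omega_0=\sum_{i=1}^3a_i\,dx_i$ on $\mathbb C^3$ whose coefficients are homogeneous polynomials of degree $d+1$ without common factor and satisfy $\sum x_ia_i=0$; $Fol(d)$ denotes the space of these foliations. A singular point is hyperbolic if in suitable holomorphic coordinates centered at it the foliation is defined by $z\,dw-\lambda w\,dz+O(|(z,w)|^2)$ with $\mathrm{Im}\,\lambda\neq0$. $\mathcal H(d)\subset Fol(d)$ is the real Zariski dense open subset (Lins Neto–Soares) each of whose members has only hyperbolic singular points and no invariant algebraic curve. For $\mathcal F\in\mathcal H(d)$ there is a unique positive current $T$ of bidimension $(1,1)$ and mass one with $i\partial\overline\partial T=0$ directed by $\mathcal F$ (i.e. $T\wedge\omega=0$ for all local holomorphic 1-forms $\omega$ defining $\mathcal F$). On a flow box $B$ disjoint from $\mathrm{Sing}(\mathcal F)$, $T=\int h_\alpha[V_\alpha]\,d\mu(\alpha)$ with $h_\alpha$ positive harmonic functions on the plaques $V_\alpha$ and $\mu$ a positive measure on a transversal, and $\partial T=\tau\wedge T$ with $\tau=\partial h_\alpha/h_\alpha$ on $V_\alpha$ for $\mu$-a.e. $\alpha$; $\tau$ does not change if $h_\alpha$ is replaced by $c_\alpha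 h_\alpha$ with $c_\alpha>0$. The (conformal, possibly vanishing at some points) metric $g_T$ on leaves is $g_T=\frac i2\tau\otimes\overline\tau$; in a holomorphic coordinate $z_\alpha$ on $V_\alpha$, $$g_T=\frac i2\left|\frac{\partial h_\alpha}{\partial z_\alpha}\right|^2\frac1{h_\alpha^2}\,dz_\alpha\otimes d\overline z_\alpha,$$ that is, $g_T$ is a positive constant multiple of $\left|\partial h_\alpha/\partial z_\alpha\right|^2h_\alpha^{-2}|dz_\alpha|^2$. The critical set is $\mathcal C_T=\{(\alpha,z):\partial h_\alpha/\partial z(\alpha,z)=0\}$. *)

(* Defs.v *)
From HB Require Import structures.
From mathcomp Require Import all_boot all_order all_algebra.
From mathcomp Require Import complex.
From mathcomp Require mpoly.
Import Order.TTheory GRing.Theory Num.Theory.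
Set Implicit Arguments.
Unset Strict Implicit.
Unset Printing Implicit Defensive.

(** ** Homogeneous 1-forms on K^3 and curves in the projective plane *)

(* The notations of [mpoly] are incompatible with those of MathComp-Analysis,
   hence a module preceding the import of the latter. *)
Module PolyForms.
Import mpoly.
Local Open Scope ring_scope.

Definition is_const (K : fieldType) (q : {mpoly K[3]}) : Prop :=
  exists c : K, q = c%:MP.

(* The 1-form sum_j a_j dx_j defines a foliation of degree [d]. *)
Definition Fol (K : fieldType) (d : nat) (a : 'I_3 -> {mpoly K[3]}) : Prop :=
  [/\ forall j, a j \is d.+1.-homog,
      forall q : {mpoly K[3]},
        (forall j, exists b : {mpoly K[3]}, a j = q * b) -> is_const q
    & \sum_(j < 3) 'X_j * a j = 0].

Definition peval (K : fieldType) (x : 'rV[K]_3) (q : {mpoly K[3]}) : K :=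
  q.@[x 0].

Definition form_at (K : fieldType) (a : 'I_3 -> {mpoly K[3]}) (x : 'rV[K]_3) :
  'rV[K]_3 := \row_j peval x (a j).

Definition irreducible3 (K : fieldType) (P : {mpoly K[3]}) : Prop :=
  ~ is_const P /\
  forall Q S : {mpoly K[3]}, P = Q * S -> is_const Q \/ is_const S.

(* The curve P = 0 is tangent to the foliation: dP and the 1-form are
   proportional along it. *)
Definition invariant_curve (K : fieldType) (a : 'I_3 -> {mpoly K[3]})
  (P : {mpoly K[3]}) : Prop :=
  [/\ exists e : nat, P \is e.-homog,
      irreducible3 P
    & forall x : 'rV[K]_3, x != 0 -> peval x P = 0 -> forall j k : 'I_3,
        peval x (a j) * peval x P^`M(k) = peval x (a k) * peval x P^`M(j)].

End PolyForms.
Export PolyForms.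

From mathcomp Require Import all_classical all_reals all_analysis.
Import numFieldNormedType.Exports.
Local Open Scope classical_set_scope.
Local Open Scope ring_scope.
Local Open Scope complex_scope.

(* The complex numbers with their topology: the alias [^o] carries the normed
   structure over itself, so [differentiable] at these types means
   complex-differentiable. *)
Notation Cx R := ((complex R)^o).
Notation Cvec R n := ('rV[Cx R]_n).
Notation Cpoly3 R := (mpoly.mpoly 3 (Cx R)).

Definition cx_of (R : realType) (p : R * R) : Cx R := p.1 +i* p.2.

(** ** Real differential calculus on complex normed spaces *)

Definition rderiv (R : realType) (V : normedModType (Cx R)) (v : V)
  (f : V -> R) (x : V) : R :=
  derive1 (fun t : R => f (x + t%:C *: v)) 0.

Definition iter_rderiv (R : realType) (V : normedModType (Cx R)) (vs : seq V)
  (f : V -> R) : V -> R :=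
  foldr (fun v g => rderiv v g) f vs.

Definition smooth_on (R : realType) (V : normedModType (Cx R)) (A : set V)
  (f : V -> R) : Prop :=
  forall (vs : seq V) (x : V), A x ->
    {for x, continuous (iter_rderiv vs f)} /\
    forall v : V, derivable (fun t : R => iter_rderiv vs f (x + t%:C *: v)) 0 1.

Definition csmooth_on (R : realType) (V : normedModType (Cx R)) (A : set V)
  (f : V -> Cx R) : Prop :=
  smooth_on A (fun x => complex.Re (f x)) /\ smooth_on A (fun x => complex.Im (f x)).

Definition crderiv (R : realType) (V : normedModType (Cx R)) (v : V)
  (f : V -> Cx R) (x : V) : Cx R :=
  rderiv v (fun y => complex.Re (f y)) x +i* rderiv v (fun y => complex.Im (f y)) x.

(* Wirtinger derivatives in the complex direction [v]. *)
Definition wirt (R : realType) (V : normedModType (Cx R)) (v : V)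
  (f : V -> Cx R) (x : V) : Cx R :=
  2^-1 * (crderiv v f x - 'i%C * crderiv ('i%C *: v) f x).

Definition wirt_bar (R : realType) (V : normedModType (Cx R)) (v : V)
  (f : V -> Cx R) (x : V) : Cx R :=
  2^-1 * (crderiv v f x + 'i%C * crderiv ('i%C *: v) f x).

Definition std_basis (R : realType) (n : nat) (j : 'I_n) : Cvec R n :=
  delta_mx 0 j.

Definition conj_tr (R : realType) (m n : nat) (A : 'M[Cx R]_(m, n)) :
  'M[Cx R]_(n, m) := (map_mx (@conjc R) A)^T.

(** ** Holomorphic foliations of the projective plane *)

Definition Sing (R : realType) (a : 'I_3 -> Cpoly3 R) : set (Cvec R 3) :=
  [set x : Cvec R 3 | x != 0 /\ form_at a x = 0].

(* Holomorphic coordinates on an open subset of the projective plane, given by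
   the inverse map lifted to homogeneous coordinates: the determinant condition
   says that the lift is nonzero and that its projectivization is an
   immersion. *)
Definition proj_chart (R : realType) (U : set (Cvec R 2))
  (Phi : Cvec R 2 -> Cvec R 3) : Prop :=
  [/\ open U,
      forall v, U v -> differentiable Phi v,
      forall v, U v ->
        \det (\matrix_(i < 3, k < 3)
          nth 0 [:: Phi v; 'D_(std_basis R 0) Phi v; 'D_(std_basis R 1) Phi v] i 0 k)
        != 0
    & forall v w, U v -> U w ->
        (exists l : Cx R, Phi w = l *: Phi v) -> v = w].

(* The coefficient on the [j]-th coordinate differential of the pullback of the
   1-form by the lifted chart. *)
Definition pullback (R : realType) (a : 'I_3 -> Cpoly3 R)
  (Phi : Cvec R 2 -> Cvec R 3) (j : 'I_2) (v : Cvec R 2) : Cx R :=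
  \sum_(k < 3) form_at a (Phi v) 0 k * ('D_(std_basis R j) Phi v : Cvec R 3) 0 k.

(* In coordinates (z, w) = (v 0 0, v 0 1), a defining form [u * pullback] is
   z dw - lambda w dz up to second order. *)
Definition hyperbolic (R : realType) (a : 'I_3 -> Cpoly3 R) (p : Cvec R 3) :
  Prop :=
  exists (U : set (Cvec R 2)) (Phi : Cvec R 2 -> Cvec R 3)
         (u : Cvec R 2 -> Cx R) (lambda M : Cx R),
    [/\ proj_chart U Phi, U 0 /\ Phi 0 = p,
        forall v, U v -> differentiable u v /\ u v != 0,
        complex.Im lambda != 0
      & \forall v \near (0 : Cvec R 2),
          `|u v * pullback a Phi 0 v + lambda * v 0 1| <= M * `|v| ^+ 2 /\
          `|u v * pullback a Phi 1 v - v 0 0| <= M * `|v| ^+ 2].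

Definition HFol (R : realType) (d : nat) (a : 'I_3 -> Cpoly3 R) : Prop :=
  [/\ Fol d a,
      forall p, Sing a p -> hyperbolic a p
    & ~ exists P : Cpoly3 R, invariant_curve a P].

(** ** Smooth forms and currents on the projective plane *)

Definition nonzero (R : realType) : set (Cvec R 3) := [set x : Cvec R 3 | x != 0].

Definition cone (R : realType) (K : set (Cvec R 3)) : set (Cvec R 3) :=
  [set x : Cvec R 3 | exists2 l : Cx R, l != 0 & exists2 y, K y & x = l *: y].

(* Forms on the projective plane are encoded by their pullbacks to the punctured
   space, i.e. by forms there which are invariant under scalars and killed by
   contraction with the radial field.  [theta] stands for the (1,1)-form
   i * sum_jk theta_jk dx_j /\ d(conj x_k); its value at 0 is irrelevant. *)
Definition form11 (R : realType) (theta : Cvec R 3 -> 'M[Cx R]_3) : Prop :=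
  [/\ forall j k, csmooth_on (@nonzero R) (fun x => theta x j k),
      forall (l : Cx R) x, l != 0 -> x != 0 ->
        theta (l *: x) = (l * conjc l)^-1 *: theta x
    & forall x, x != 0 ->
        x *m theta x = 0 /\ theta x *m conj_tr x = 0].

(* [phi] stands for sum_k phi_k d(conj x_k). *)
Definition form01 (R : realType) (phi : Cvec R 3 -> Cvec R 3) : Prop :=
  [/\ forall k, csmooth_on (@nonzero R) (fun x => phi x 0 k),
      forall (l : Cx R) x, l != 0 -> x != 0 ->
        phi (l *: x) = (conjc l)^-1 *: phi x
    & forall x, x != 0 -> phi x *m conj_tr x = 0].

Definition form0 (R : realType) (u : Cvec R 3 -> Cx R) : Prop :=
  csmooth_on (@nonzero R) u /\
  forall (l : Cx R) x, l != 0 -> x != 0 -> u (l *: x) = u x.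

Definition compactly_supported_in (R : realType) (W : zmodType)
  (U : set (Cvec R 3)) (f : Cvec R 3 -> W) : Prop :=
  exists K : set (Cvec R 3), [/\ compact K, K `<=` U, K `<=` @nonzero R
    & forall x, x != 0 -> ~ cone K x -> f x = 0].

Definition positive11 (R : realType) (theta : Cvec R 3 -> 'M[Cx R]_3) : Prop :=
  forall x, x != 0 -> forall v : Cvec R 3, 0 <= (v *m theta x *m conj_tr v) 0 0.

Definition ddbar (R : realType) (u : Cvec R 3 -> Cx R) (x : Cvec R 3) :
  'M[Cx R]_3 :=
  \matrix_(j, k) wirt (std_basis R j) (wirt_bar (std_basis R k) u) x.

Definition sqnorm (R : realType) (x : Cvec R 3) : Cx R := (x *m conj_tr x) 0 0.

(* (i / 2 pi) ddbar log |x|^2, of total mass one on a line. *)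
Definition fubini_study (R : realType) (x : Cvec R 3) : 'M[Cx R]_3 :=
  \matrix_(j, k) ((2 * (pi : R)%:C)^-1 *
    ((j == k)%:R / sqnorm x - conjc (x 0 j) * x 0 k / sqnorm x ^+ 2)).

Definition wedge_form (R : realType) (w phi : Cvec R 3) : 'M[Cx R]_3 :=
  - 'i%C *: (w^T *m phi).

(* A positive current of bidimension (1,1); continuity is automatic since a
   positive functional on (1,1)-forms of a compact manifold has order 0. *)
Definition positive_current (R : realType)
  (T : (Cvec R 3 -> 'M[Cx R]_3) -> Cx R) : Prop :=
  [/\ forall theta theta', form11 theta -> form11 theta' ->
        (forall x, x != 0 -> theta x = theta' x) -> T theta = T theta',
      forall (c : Cx R) theta theta', form11 theta -> form11 theta' ->
        T (fun x => c *: theta x + theta' x) = c * T theta + T theta'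
    & forall theta, form11 theta -> positive11 theta -> 0 <= T theta].

(* [w] is a holomorphic 1-form defining the foliation on the open subset of the
   projective plane whose cone is [U]: the homogeneous form divided by a
   nonvanishing local section of degree d + 2. *)
Definition local_defining_form (R : realType) (d : nat)
  (a : 'I_3 -> Cpoly3 R) (U : set (Cvec R 3)) (w : Cvec R 3 -> Cvec R 3) :
  Prop :=
  [/\ open U, U `<=` @nonzero R,
      forall (l : Cx R) x, l != 0 -> U x -> U (l *: x)
    & exists g : Cvec R 3 -> Cx R,
        [/\ forall x, U x -> differentiable g x /\ g x != 0,
            forall (l : Cx R) x, l != 0 -> U x -> g (l *: x) = l ^- d.+2 * g x
          & forall x, U x -> w x = g x *: form_at a x]].

Definition directed_by (R : realType) (d : nat) (a : 'I_3 -> Cpoly3 R)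
  (T : (Cvec R 3 -> 'M[Cx R]_3) -> Cx R) : Prop :=
  forall (U : set (Cvec R 3)) (w phi : Cvec R 3 -> Cvec R 3),
    local_defining_form d a U w ->
    form01 phi -> compactly_supported_in U phi ->
    T (fun x => wedge_form (w x) (phi x)) = 0.

Definition directed_harmonic_current (R : realType) (d : nat)
  (a : 'I_3 -> Cpoly3 R) (T : (Cvec R 3 -> 'M[Cx R]_3) -> Cx R) : Prop :=
  [/\ positive_current T,
      T (@fubini_study R) = 1,
      forall u, form0 u -> T (ddbar u) = 0
    & directed_by d a T].

(** ** Flow boxes and the local structure of the current *)

Definition box (R : realType) (D S : set (Cx R)) : set (Cvec R 2) :=
  [set v : Cvec R 2 | D (v 0 0) /\ S (v 0 1)].

Definition pt (R : realType) (z alpha : Cx R) : Cvec R 2 :=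
  \row_j (if j == 0 then z else alpha).

(* [D] parametrizes the plaques, [S] is the transversal; the last condition says
   that the plaques are tangent to the foliation. *)
Definition flow_box (R : realType) (a : 'I_3 -> Cpoly3 R) (D S : set (Cx R))
  (Phi : Cvec R 2 -> Cvec R 3) : Prop :=
  [/\ open D /\ connected D, open S, proj_chart (box D S) Phi,
      forall v, box D S v -> ~ Sing a (Phi v)
    & forall v, box D S v -> pullback a Phi 0 v = 0].

(* The real partial derivatives d/dx (for 0) and d/dy (for 1) on C. *)
Definition pd (R : realType) (i : 'I_2) (f : Cx R -> R) : Cx R -> R :=
  rderiv (V := Cx R) (if i == 0 then 1 else 'i%C) f.

Definition harmonic_on (R : realType) (D : set (Cx R)) (h : Cx R -> R) : Prop :=
  smooth_on (V := Cx R) D h /\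
  forall z, D z -> pd 0 (pd 0 h) z + pd 1 (pd 1 h) z = 0.

(* Density of the (1,1)-form [theta] restricted to the plaque of [alpha], with
   respect to Lebesgue measure dx dy; the factor 2 is i dz /\ d(conj z) = 2 dx dy. *)
Definition plaque_density (R : realType) (Phi : Cvec R 2 -> Cvec R 3)
  (theta : Cvec R 3 -> 'M[Cx R]_3) (alpha z : Cx R) : Cx R :=
  let v := pt z alpha in
  let dPhi : Cvec R 3 := 'D_(std_basis R 0) Phi v in
  2 * (dPhi *m theta (Phi v) *m conj_tr dPhi) 0 0.

Definition area (R : realType) :=
  (@lebesgue_measure R \x @lebesgue_measure R)%E.

(* Real and imaginary parts (for [part] = [Re] or [Im]) of the integral of
   h_alpha * theta over the plaque of [alpha]. *)
Definition plaque_integral (R : realType) (part : R[i] -> R) (D : set (Cx R))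
  (Phi : Cvec R 2 -> Cvec R 3) (h : Cx R -> Cx R -> R)
  (theta : Cvec R 3 -> 'M[Cx R]_3) (alpha : Cx R) : R :=
  \int[@area R]_(p in @cx_of R @^-1` D)
    (h alpha (cx_of p) * part (plaque_density Phi theta alpha (cx_of p))).

(* On the box, T is the integral over the transversal of h_alpha [V_alpha]. *)
Definition harmonic_decomposition (R : realType)
  (T : (Cvec R 3 -> 'M[Cx R]_3) -> Cx R) (D S : set (Cx R))
  (Phi : Cvec R 2 -> Cvec R 3) (h : Cx R -> Cx R -> R)
  (mu : {measure set (R * R)%type -> \bar R}) : Prop :=
  [/\ {ae mu, forall al, S (cx_of al) ->
        harmonic_on D (h (cx_of al)) /\ forall z, D z -> 0 < h (cx_of al) z},
      forall K : set (Cx R), compact K -> K `<=` S ->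
        (mu (@cx_of R @^-1` K) < +oo)%E
    & forall theta, form11 theta ->
        (exists2 K : set (Cvec R 2), compact K /\ K `<=` box D S &
          forall x, x != 0 -> ~ cone (Phi @` K) x -> theta x = 0) ->
        let I part al := plaque_integral part D Phi h theta (cx_of al) in
        let S' := @cx_of R @^-1` S in
        [/\ mu.-integrable S' (EFin \o I (@complex.Re R)),
            mu.-integrable S' (EFin \o I (@complex.Im R))
          & T theta = (\int[mu]_(al in S') I (@complex.Re R) al) +i*
                      (\int[mu]_(al in S') I (@complex.Im R) al)]].

(** ** The metric and its curvature *)

Definition dz_h (R : realType) (h : Cx R -> R) (z : Cx R) : Cx R :=
  wirt (V := Cx R) 1 (fun y => (h y)%:C) z.

Definition tau (R : realType) (h : Cx R -> R) (z : Cx R) : Cx R :=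
  dz_h h z / (h z)%:C.

(* The Riemannian metric (i/2) tau (x) conj tau, as its Gram matrix in the real
   coordinates (x, y): (i/2) dz (x) conj dz is the Euclidean metric dx^2 + dy^2,
   of area form (i/2) dz /\ conj dz. *)
Definition g_T (R : realType) (h : Cx R -> R) (z : Cx R) : 'M[R]_2 :=
  (complex.Re (`|tau h z| ^+ 2))%:M.

Definition critical (R : realType) (h : Cx R -> R) : set (Cx R) :=
  [set z : Cx R | dz_h h z = 0].

Definition christoffel (R : realType) (g : Cx R -> 'M[R]_2) (k i j : 'I_2)
  (z : Cx R) : R :=
  2^-1 * \sum_(l < 2) invmx (g z) k l *
    (pd i (fun y => g y j l) z + pd j (fun y => g y i l) z
     - pd l (fun y => g y i j) z).

(* The component on d_l of R(d_i, d_j) d_k. *)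
Definition riemann (R : realType) (g : Cx R -> 'M[R]_2) (l k i j : 'I_2)
  (z : Cx R) : R :=
  pd i (christoffel g l j k) z - pd j (christoffel g l i k) z
  + \sum_(m < 2) (christoffel g l i m z * christoffel g m j k z
                  - christoffel g l j m z * christoffel g m i k z).

Definition gauss_curvature (R : realType) (g : Cx R -> 'M[R]_2) (z : Cx R) : R :=
  (\sum_(l < 2) g z 0 l * riemann g l 1 0 1 z) / \det (g z).

(* Main.v *)
Require Import Defs.
From mathcomp Require Import all_boot all_order all_algebra.
From mathcomp Require Import complex.
From mathcomp Require Import all_classical all_reals all_analysis.
From mathcomp Require mpoly.
From mathcomp Require Import ring lra.
Set Implicit Arguments.
Unset Strict Implicit.
Unset Printing Implicit Defensive.
Import Order.TTheory GRing.Theory Num.Theory.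
Import numFieldNormedType.Exports.
Local Open Scope classical_set_scope.
Local Open Scope ring_scope.
Local Open Scope complex_scope.

(** On a plaque of the flow box let h be the density of T, p = h_x, q = h_y and
    N = p^2 + q^2.  Since dh/dz = (p - i q) / 2, the metric is E |dz|^2 with
    E = N / (4 h^2), so its Gauss curvature is - Delta (log E) / (2 E), where
      log E = log N - 2 log h - log 4.
    Off the critical set log N is harmonic, because N = 4 |dh/dz|^2 and dh/dz is
    holomorphic for harmonic h; and Delta (log h) = - N / h^2 = - 4 E because
    Delta h = 0.  Hence Delta (log E) = 8 E and the curvature is - 4 on every
    plaque whose density is harmonic and positive, that is on almost every one.

    The formal proof carries this out with real partial derivatives.  Writing
    phi_i = (d_i E) / (2 E) for half the logarithmic derivative,
    [gauss_curvature_conformal] reduces the curvature of E |dz|^2 to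
    - (d_x phi_0 + d_y phi_1) / E; [is_rderiv_half_dlog] computes the derivatives
    of phi_i from those of h, p and q; and [liouville_identity] is the resulting
    algebraic identity.  Its inputs are h_xy = h_yx and the harmonicity of h, p
    and q.  The harmonicity of p and q rests on the symmetry of mixed
    directional derivatives, [rderivC], which is proved from the mean value
    theorem. *)

(** * Derivatives along real lines *)

(** The real derivative of f at x in the direction v exists and equals l;
    [rderiv] alone is total, so it says nothing about existence. *)
Definition is_rderiv (R : realType) (V : normedModType (Cx R)) (v : V)
  (f : V -> R) (x : V) (l : R) : Prop :=
  is_derive (0 : R) 1 (fun t : R => f (x + t%:C *: v)) l.

Section RealDirectionalCalculus.
Context {R : realType} {V : normedModType (Cx R)}.
Implicit Types (v w x : V) (f g : V -> R) (A : set V).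

Lemma norm_realC (t : R) : `|t%:C : Cx R| = `|t|%:C.
Proof. by rewrite normc_def /= expr0n addr0 sqrtr_sqr. Qed.

Lemma is_rderivE v f x l : is_rderiv v f x l -> rderiv v f x = l.
Proof. by move=> [_ fl]; rewrite /rderiv derive1E. Qed.

Lemma rderivP v f x :
  derivable (fun t : R => f (x + t%:C *: v)) 0 1 ->
  is_rderiv v f x (rderiv v f x).
Proof. by move=> df; rewrite /rderiv derive1E; exact: derivableP. Qed.

Lemma nbhs_parallelogram x v w A : nbhs x A ->
  exists2 k : R, 0 < k & forall s t : R, `|s| <= k -> `|t| <= k ->
    A (x + s%:C *: v + t%:C *: w).
Proof.
move=> /nbhs_ballP[e e0 xeA].
have [e' e'0 ee'] : exists2 e' : R, 0 < e' & e'%:C <= e.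
  have := e0 : (0 : R[i]) < e; rewrite ltcE /= => /andP[/eqP ei0 er0].
  exists (complex.Re e) => //; suff: (complex.Re e)%:C <= e :> R[i] by [].
  by rewrite lecE /= ei0 eqxx lexx.
have normE (y : V) : exists2 r : R, 0 <= r & `|y| = r%:C.
  have := normr_ge0 y : (0 : R[i]) <= `|y|.
  rewrite lecE => /andP[/eqP /= y0 yr]; exists (complex.Re `|y|) => //.
  by apply/eqP; rewrite eq_complex /= y0 !eqxx.
have [[a a0 va] [b b0 wb]] := (normE v, normE w).
have d0 : 0 < a + b + 1 by lra.
exists (e' / (a + b + 1)); first by rewrite divr_gt0.
move=> s t sk tk; apply: xeA; rewrite -ball_normE /ball_ /=; apply: lt_le_trans ee'.
rewrite -addrA opprD addrA subrr sub0r normrN.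
apply: le_lt_trans (ler_normD _ _) _; rewrite !normrZ !norm_realC va wb.
rewrite -!rmorphM -rmorphD /=.
suff: (`|s| * a + `|t| * b)%:C < e'%:C :> R[i] by [].
rewrite ltcE /= eqxx /=.
set k := e' / (a + b + 1) in sk tk.
have k0 : 0 < k by rewrite divr_gt0.
have -> : e' = k * (a + b + 1) by rewrite divfK // gt_eqF.
have := ler_wpM2r a0 sk; have := ler_wpM2r b0 tk; lra.
Qed.

Lemma nbhs_line x v A : nbhs x A -> \forall t \near (0 : R), A (x + t%:C *: v).
Proof.
move=> /(@nbhs_parallelogram x v 0 A)[k k0 kA].
exists k => //= t; rewrite /ball_ /= sub0r normrN => /ltW tk.
by have := kA t 0 tk; rewrite scaler0 addr0; apply; rewrite normr0 ltW.
Qed.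

Lemma line0 x v : x + (0 : R)%:C *: v = x.
Proof. by rewrite rmorph0 scale0r addr0. Qed.

Lemma near_is_rderiv v f g x l :
  (\forall y \near x, f y = g y) -> is_rderiv v f x l -> is_rderiv v g x l.
Proof.
by move=> fg; apply: near_eq_is_derive; exact: (@nbhs_line x v _ fg).
Qed.

(** [rderiv] only sees the values of a function near the point, so identities
    that hold on an open set may be differentiated. *)
Lemma near_rderiv v f g x :
  (\forall y \near x, f y = g y) -> rderiv v f x = rderiv v g x.
Proof.
move=> fg; rewrite /rderiv !derive1E; apply: near_eq_derive.
exact: (@nbhs_line x v _ fg).
Qed.

Lemma is_rderiv_cst v x (c : R) : is_rderiv v (fun=> c) x 0.
Proof. exact: is_derive_cst. Qed.

Lemma is_rderivD v f g x a b : is_rderiv v f x a -> is_rderiv v g x b ->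
  is_rderiv v (fun y => f y + g y) x (a + b).
Proof. exact: is_deriveD. Qed.

Lemma is_rderivB v f g x a b : is_rderiv v f x a -> is_rderiv v g x b ->
  is_rderiv v (fun y => f y - g y) x (a - b).
Proof. exact: is_deriveB. Qed.

Lemma is_rderivM v f g x a b : is_rderiv v f x a -> is_rderiv v g x b ->
  is_rderiv v (fun y => f y * g y) x (f x * b + g x * a).
Proof.
move=> fa gb; apply: is_derive_eq (is_deriveM fa gb) _.
by rewrite /= !line0.
Qed.

Lemma is_rderivV v f x a : f x != 0 -> is_rderiv v f x a ->
  is_rderiv v (fun y => (f y)^-1) x (- (f x) ^- 2 * a).
Proof.
move=> f0 fa; apply: is_derive_eq.
  by apply: is_deriveV fa; rewrite /= !line0.
by rewrite /= !line0.
Qed.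

(** [is_rderiv] speaks of the parameter 0 only; moving the base point along the
    line gives the derivative at every parameter, as the mean value theorem
    requires. *)
Lemma is_derive_line v f x (s l : R) :
  is_rderiv v f (x + s%:C *: v) l ->
  is_derive s 1 (fun t : R => f (x + t%:C *: v)) l.
Proof.
move=> fl; pose g t := f (x + s%:C *: v + t%:C *: v).
have fE : (fun t : R => f (x + t%:C *: v)) = g \o (fun t => t - s).
  apply/funext => t; rewrite /g /=; congr f.
  by rewrite -addrA -scalerDl -rmorphD [s + _]addrC subrK.
have gs : is_derive (s - s) 1 g l by rewrite subrr.
have ss : is_derive s 1 (fun t => t - s) 1 by exact: (is_derive_shift s 1 (- s)).
rewrite fE; have := @is_derive1_comp _ g (fun t => t - s) s _ _ gs ss.
by rewrite mulr1.
Qed.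

Lemma smooth_on_rderiv A f v : smooth_on A f -> smooth_on A (rderiv v f).
Proof.
move=> sf vs x Ax; have := sf (rcons vs v) x Ax.
by rewrite /iter_rderiv -cats1 foldr_cat.
Qed.

Lemma smooth_on_is_rderiv A f v x : smooth_on A f -> A x ->
  is_rderiv v f x (rderiv v f x).
Proof. by move=> sf Ax; apply: rderivP; exact: (sf [::] x Ax).2. Qed.

Lemma smooth_on_continuous A f x : smooth_on A f -> A x -> {for x, continuous f}.
Proof. by move=> sf Ax; exact: (sf [::] x Ax).1. Qed.

(** * Symmetry of mixed derivatives *)

(** Two applications of the mean value theorem: the second difference is the
    increment over [0, k] of s |-> f (x + s v + k w) - f (x + s v), and the
    derivative of that function at the intermediate point is itself an
    increment in the direction w. *)
Lemma second_difference A f v w x (k : R) : smooth_on A f -> 0 < k ->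
  (forall s t : R, 0 <= s <= k -> 0 <= t <= k ->
    A (x + s%:C *: v + t%:C *: w)) ->
  exists s t : R, [/\ 0 <= s <= k, 0 <= t <= k &
    f (x + k%:C *: v + k%:C *: w) - f (x + k%:C *: v) - f (x + k%:C *: w) + f x
    = rderiv w (rderiv v f) (x + s%:C *: v + t%:C *: w) * k ^+ 2].
Proof.
move=> sf k0 kA.
have k1 : 0 <= k <= k by rewrite lexx ltW.
have k2 : 0 <= (0 : R) <= k by rewrite lexx ltW.
have sfv := smooth_on_rderiv v sf.
pose u s := f (x + k%:C *: w + s%:C *: v) - f (x + s%:C *: v).
pose du s := rderiv v f (x + k%:C *: w + s%:C *: v) - rderiv v f (x + s%:C *: v).
have uE s : s \in `[0, k] -> is_derive s 1 u (du s).
  rewrite in_itv /= => sk; apply: is_deriveB.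
    apply: is_derive_line; apply: smooth_on_is_rderiv sf _.
    by rewrite addrAC; exact: kA.
  apply: is_derive_line; apply: smooth_on_is_rderiv sf _.
  by have := kA s 0 sk k2; rewrite line0.
have uc : {within `[0, k], continuous u}.
  by apply: derivable_within_continuous => s /uE[].
have uE' s : s \in `]0, k[ -> is_derive s 1 u (du s).
  by move=> sk; apply: uE; exact: subset_itv_oo_cc sk.
have [s sk us] := MVT_segment (ltW k0) uE' uc.
have {}sk : 0 <= s <= k by move: sk; rewrite in_itv.
pose p t := rderiv v f (x + s%:C *: v + t%:C *: w).
pose dp t := rderiv w (rderiv v f) (x + s%:C *: v + t%:C *: w).
have pE t : t \in `[0, k] -> is_derive t 1 p (dp t).
  rewrite in_itv /= => tk.
  by apply: is_derive_line; apply: smooth_on_is_rderiv sfv _; exact: kA.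
have pc : {within `[0, k], continuous p}.
  by apply: derivable_within_continuous => t /pE[].
have pE' t : t \in `]0, k[ -> is_derive t 1 p (dp t).
  by move=> tk; apply: pE; exact: subset_itv_oo_cc tk.
have [t tk pt] := MVT_segment (ltW k0) pE' pc.
exists s, t; split => //.
have duE : du s = p k - p 0 by rewrite /du /p line0 addrAC.
move: us; rewrite duE pt /u subr0 !line0 -/(dp t) expr2 mulrA => <-.
rewrite (addrAC x); lra.
Qed.

Lemma eq_at_limit (F G : V -> R) x :
  {for x, continuous F} -> {for x, continuous G} ->
  (forall B, nbhs x B -> exists y1 y2, [/\ B y1, B y2 & F y1 = G y2]) ->
  F x = G x.
Proof.
move=> Fc Gc FG; apply/eqP; apply/negPn/negP => neq.
pose e := `|F x - G x| / 2.
have e0 : 0 < e by rewrite divr_gt0 // normr_gt0 subr_eq0.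
have nF : \forall y \near x, `|F x - F y| < e by exact: cvgr_dist_lt Fc _ e0.
have nG : \forall y \near x, `|G x - G y| < e by exact: cvgr_dist_lt Gc _ e0.
have [y1 [y2 [[Fe _] [_ Ge] FGy]]] := FG _ (filterI nF nG).
have : `|F x - G x| < e + e.
  rewrite FGy in Fe; rewrite distrC in Ge.
  apply: le_lt_trans (ltrD Fe Ge); apply: le_trans (ler_normD _ _).
  by rewrite addrA subrK.
by rewrite /e -splitr ltxx.
Qed.

(** The second difference is symmetric in v and w, so by [second_difference] the
    two mixed derivatives agree at points arbitrarily close to x, and both are
    continuous. *)
Lemma rderivC A f v w x : open A -> smooth_on A f -> A x ->
  rderiv v (rderiv w f) x = rderiv w (rderiv v f) x.
Proof.
move=> oA sf Ax.
have Fc := smooth_on_continuous (smooth_on_rderiv v (smooth_on_rderiv w sf)) Ax.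
have Gc := smooth_on_continuous (smooth_on_rderiv w (smooth_on_rderiv v sf)) Ax.
have dF (k : R) := @second_difference A f w v x k sf.
have dG (k : R) := @second_difference A f v w x k sf.
move: (rderiv v _) (rderiv w _) Fc Gc dF dG => F G Fc Gc dF dG.
apply: (eq_at_limit Fc Gc) => B xB.
have nAB : nbhs x (A `&` B) by apply: filterI => //; exact: open_nbhs_nbhs.
have [k k0 kAB] := nbhs_parallelogram v w nAB.
have {}kAB (s t : R) : 0 <= s <= k -> 0 <= t <= k ->
    (A `&` B) (x + s%:C *: v + t%:C *: w).
  by move=> /andP[s0 sk] /andP[t0 tk]; apply: kAB; rewrite ger0_norm.
have [s' t' sk' tk'|s' [t' [sk' tk' st']]] := dF k k0.
  by rewrite addrAC; have [] := kAB _ _ tk' sk'.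
have [s t sk tk|s [t [sk tk st]]] := dG k k0.
  by have [] := kAB _ _ sk tk.
exists (x + t'%:C *: v + s'%:C *: w), (x + s%:C *: v + t%:C *: w).
have [[_ B1] [_ B2]] := (kAB _ _ tk' sk', kAB _ _ sk tk).
split=> //; apply: (@mulIf _ (k ^+ 2)); first by rewrite expf_neq0 // gt_eqF.
rewrite -st (addrAC x (t'%:C *: v)) -st' (addrAC x (k%:C *: w)); ring.
Qed.

End RealDirectionalCalculus.

(** * Curvature of a conformal metric *)

Definition pdir (R : realType) (i : 'I_2) : Cx R := if i == 0 then 1 else 'i%C.

Section ConformalMetric.
Context {R : realType}.
Implicit Types (E : Cx R -> R) (z : Cx R).

Definition half_dlog (i : 'I_2) E z : R := pd i E z / (2 * E z).

Lemma pd_cst (i : 'I_2) (c : R) z : pd i (fun=> c) z = 0.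
Proof. exact: is_rderivE (is_rderiv_cst (pdir R i) z c). Qed.

Lemma pd_scalar_mx E (i j l : 'I_2) z :
  pd i (fun y => ((E y)%:M : 'M[R]_2) j l) z = (j == l)%:R * pd i E z.
Proof.
have [->|jl] := eqVneq j l.
  rewrite mul1r; suff -> : (fun y => ((E y)%:M : 'M[R]_2) l l) = E by [].
  by apply/funext => y; rewrite mxE eqxx.
rewrite mul0r -(pd_cst i 0 z).
suff -> : (fun y => ((E y)%:M : 'M[R]_2) j l) = fun=> 0 by [].
by apply/funext => y; rewrite mxE (negPf jl).
Qed.

(** Where E vanishes, [invmx] returns a scalar matrix with entry E^-1 = 0, and
    [half_dlog] is 0 as well; so the formula holds at every point, and it can
    be differentiated without restricting to the set where E does not vanish. *)
Lemma christoffel_conformal E (k i j : 'I_2) z :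
  christoffel (fun y => (E y)%:M) k i j z =
  (k == j)%:R * half_dlog i E z + (k == i)%:R * half_dlog j E z
  - (i == j)%:R * half_dlog k E z.
Proof.
rewrite /christoffel (bigD1 k) //= big1 => [|l lk]; last first.
  by rewrite invmx_scalar mxE eq_sym (negPf lk) mul0r.
rewrite addr0 invmx_scalar mxE eqxx mulr1n !pd_scalar_mx /half_dlog invfM.
by rewrite !(eq_sym k); ring.
Qed.

(** The terms quadratic in the Christoffel symbols cancel, which leaves
    - (d_x phi_0 + d_y phi_1) / E with phi_i the functions [half_dlog i E]. *)
Lemma gauss_curvature_conformal E z (a b : R) :
  is_rderiv (pdir R 0) (half_dlog 0 E) z a ->
  is_rderiv (pdir R 1) (half_dlog 1 E) z b ->
  gauss_curvature (fun y => (E y)%:M) z = - (a + b) / E z.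
Proof.
move=> da db; rewrite /gauss_curvature det_scalar.
rewrite big_ord_recl big_ord1 !mxE /= mulr1n mulr0n mul0r addr0.
rewrite /riemann !big_ord_recl big_ord0 !christoffel_conformal /=.
have -> : lift ord0 ord0 = 1 :> 'I_2 by exact/val_inj.
have -> : christoffel (fun y => (E y)%:M) 0 1 1 = (fun y => 0 - half_dlog 0 E y).
  by apply/funext => y; rewrite christoffel_conformal /=; ring.
have -> : christoffel (fun y => (E y)%:M) 0 0 1 = half_dlog 1 E.
  by apply/funext => y; rewrite christoffel_conformal /=; ring.
have -> : pd 0 (fun y => 0 - half_dlog 0 E y) z = 0 - a.
  exact: is_rderivE (is_rderivB (is_rderiv_cst (pdir R 0) z 0) da).
have -> : pd 1 (half_dlog 1 E) z = b by exact: is_rderivE db.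
move: (half_dlog 0 E z) (half_dlog 1 E z) => u v.
have [->|E0] := eqVneq (E z) 0; first by rewrite invr0 !mulr0 !mul0r.
by field.
Qed.
End ConformalMetric.

(** * The logarithmic derivative of (p^2 + q^2) / (4 h^2) *)

Section HalfLogDerivative.
Context {R : realType} {V : normedModType (Cx R)}.
Implicit Types (h p q : V -> R).

(** Near x, half the logarithmic derivative of E is
    (p p_v + q q_v) / (p^2 + q^2) - h_v / h, which is then differentiated
    once more. *)
Lemma is_rderiv_half_dlog h p q hv pv qv v x (hvv pvv qvv : R) :
    (\forall y \near x, is_rderiv v h y (hv y)) -> is_rderiv v hv x hvv ->
    (\forall y \near x, is_rderiv v p y (pv y)) -> is_rderiv v pv x pvv ->
    (\forall y \near x, is_rderiv v q y (qv y)) -> is_rderiv v qv x qvv ->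
    (\forall y \near x, h y != 0) ->
    (\forall y \near x, p y ^+ 2 + q y ^+ 2 != 0) ->
  let E y := (p y ^+ 2 + q y ^+ 2) / (4 * h y ^+ 2) in
  is_rderiv v (fun y => rderiv v E y / (2 * E y)) x
    ((pv x ^+ 2 + qv x ^+ 2 + p x * pvv + q x * qvv) / (p x ^+ 2 + q x ^+ 2)
     - 2 * (p x * pv x + q x * qv x) ^+ 2 / (p x ^+ 2 + q x ^+ 2) ^+ 2
     - hvv / h x + hv x ^+ 2 / h x ^+ 2).
Proof.
move=> nh dhv np dpv nq dqv h0 N0 E.
have dN y : is_rderiv v p y (pv y) -> is_rderiv v q y (qv y) ->
    is_rderiv v (fun y => p y * p y + q y * q y) y
      (p y * pv y + p y * pv y + (q y * qv y + q y * qv y)).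
  by move=> dp dq; apply: is_rderivD; exact: is_rderivM.
have dE y : is_rderiv v h y (hv y) -> is_rderiv v p y (pv y) ->
    is_rderiv v q y (qv y) -> h y != 0 -> p y ^+ 2 + q y ^+ 2 != 0 ->
    (p y * pv y + q y * qv y) * (p y * p y + q y * q y)^-1 - hv y * (h y)^-1 =
    rderiv v E y / (2 * E y).
  move=> dh dp dq hy Ny.
  have dh2 := is_rderivM (is_rderiv_cst v y 4) (is_rderivM dh dh).
  have hh0 : 4 * (h y * h y) != 0 by rewrite !mulf_neq0 // pnatr_eq0.
  have /is_rderivE -> := is_rderivM (dN y dp dq) (is_rderivV hh0 dh2).
  by rewrite /E; field; apply/andP.
apply: (near_is_rderiv (f := fun y => (p y * pv y + q y * qv y) *
   (p y * p y + q y * q y)^-1 - hv y * (h y)^-1)).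
  by near=> y; apply: dE; near: y.
have [dh dp dq] := And3 (nbhs_singleton nh) (nbhs_singleton np) (nbhs_singleton nq).
have [hx Nx] := (nbhs_singleton h0, nbhs_singleton N0).
have := is_rderivB
  (is_rderivM (is_rderivD (is_rderivM dp dpv) (is_rderivM dq dqv))
              (is_rderivV (f := fun y => p y * p y + q y * q y) Nx (dN x dp dq)))
  (is_rderivM dhv (is_rderivV hx dh)).
congr is_rderiv.
by field; apply/andP.
Unshelve. all: by end_near. Qed.
End HalfLogDerivative.

(** * Harmonic functions and the metric *)

(** This is the identity Delta (log E) = 8 E written in the derivatives of a
    harmonic function u at one point, p and q being u_x and u_y.  With py = qx
    and qy = - px the terms in pxx, pyy, qxx and qyy cancel, and the terms
    quadratic in px and qx add up to
      2 (px^2 + qx^2) / N - 2 ((p px + q qx)^2 + (p qx - q px)^2) / N^2,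
    which vanishes by Lagrange's identity; what remains is N / u^2. *)
Lemma liouville_identity (F : numFieldType)
    (p q u px py qx qy pxx pyy qxx qyy : F) :
  qx = py -> px + qy = 0 -> pxx + pyy = 0 -> qxx + qyy = 0 ->
  u != 0 -> p ^+ 2 + q ^+ 2 != 0 ->
  - ((px ^+ 2 + qx ^+ 2 + p * pxx + q * qxx) / (p ^+ 2 + q ^+ 2)
     - 2 * (p * px + q * qx) ^+ 2 / (p ^+ 2 + q ^+ 2) ^+ 2
     - px / u + p ^+ 2 / u ^+ 2
     + ((py ^+ 2 + qy ^+ 2 + p * pyy + q * qyy) / (p ^+ 2 + q ^+ 2)
     - 2 * (p * py + q * qy) ^+ 2 / (p ^+ 2 + q ^+ 2) ^+ 2
     - qy / u + q ^+ 2 / u ^+ 2)) / ((p ^+ 2 + q ^+ 2) / (4 * u ^+ 2)) = - 4.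
Proof.
move=> -> /eqP; rewrite addrC addr_eq0 => /eqP ->.
move=> /eqP; rewrite addrC addr_eq0 => /eqP ->.
move=> /eqP; rewrite addrC addr_eq0 => /eqP -> u0 N0.
by field; apply/andP.
Qed.

Section HarmonicMetric.
Context {R : realType}.
Implicit Types (D : set (Cx R)) (h : Cx R -> R) (z : Cx R).

Lemma smooth_on_pd (i : 'I_2) D h :
  smooth_on (V := Cx R) D h -> smooth_on (V := Cx R) D (pd i h).
Proof. exact: (@smooth_on_rderiv _ (Cx R) D h (pdir R i)). Qed.

Lemma smooth_on_is_pd (i : 'I_2) D h z : smooth_on (V := Cx R) D h -> D z ->
  is_rderiv (pdir R i) h z (pd i h z).
Proof. exact: (@smooth_on_is_rderiv _ (Cx R) D h (pdir R i)). Qed.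

Lemma pdC (i j : 'I_2) D h z : open D -> smooth_on (V := Cx R) D h -> D z ->
  pd i (pd j h) z = pd j (pd i h) z.
Proof. exact: (@rderivC _ (Cx R) D h (pdir R i) (pdir R j)). Qed.

Lemma eq_on_pd (i : 'I_2) D (f g : Cx R -> R) z : open D -> D z ->
  (forall y, D y -> f y = g y) -> pd i f z = pd i g z.
Proof.
move=> oD Dz fg; apply: (@near_rderiv _ (Cx R) (pdir R i)).
by apply: filterS fg _; exact: open_nbhs_nbhs.
Qed.

(** Partial derivatives commute, so the Laplacian of a partial derivative of h is
    the partial derivative of the Laplacian of h, which vanishes near z. *)
Lemma harmonic_on_pd (i : 'I_2) D h : open D ->
  harmonic_on D h -> harmonic_on D (pd i h).
Proof.
move=> oD [sh lap]; split=> [|z Dz]; first exact: smooth_on_pd.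
have swap (j : 'I_2) : pd j (pd j (pd i h)) z = pd i (pd j (pd j h)) z.
  rewrite -(pdC j i oD (smooth_on_pd j sh) Dz).
  by apply: (eq_on_pd j oD Dz) => y Dy; exact: pdC oD sh Dy.
have dpd (j : 'I_2) := smooth_on_is_pd i (smooth_on_pd j (smooth_on_pd j sh)) Dz.
have dlap : pd i (fun y => pd 0 (pd 0 h) y + pd 1 (pd 1 h) y) z =
    pd i (pd 0 (pd 0 h)) z + pd i (pd 1 (pd 1 h)) z.
  exact: is_rderivE (is_rderivD (dpd 0) (dpd 1)).
apply: etrans (congr2 +%R (swap 0) (swap 1)) _.
exact: etrans (esym dlap) (etrans (eq_on_pd i oD Dz lap) (pd_cst i 0 z)).
Qed.

Lemma dz_hE h z : dz_h h z = 2^-1 * (pd 0 h z -i* pd 1 h z).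
Proof.
rewrite /dz_h /wirt /crderiv /=; congr (_ * _).
rewrite !(is_rderivE (is_rderiv_cst _ z 0)) scaler1 -/(pd 0 h z) -/(pd 1 h z).
move: (pd 0 h z) (pd 1 h z) => u v.
by apply/eqP; rewrite eq_complex /=; apply/andP; split; apply/eqP; ring.
Qed.

Lemma g_TE h :
  g_T h = fun z => ((pd 0 h z ^+ 2 + pd 1 h z ^+ 2) / (4 * h z ^+ 2))%:M.
Proof.
apply/funext => z; rewrite /g_T /tau dz_hE.
move: (pd 0 h z) (pd 1 h z) (h z) => u v w; congr (_%:M).
rewrite normrM normfV exprMn exprVn -!add_Re2_Im2.
have -> : 2^-1 * (u -i* v) = (u / 2) -i* (v / 2) :> R[i].
  rewrite -[2 in LHS](rmorph_nat (real_complex R)) -fmorphV.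
  by apply/eqP; rewrite eq_complex /=; apply/andP; split; apply/eqP; ring.
rewrite -fmorphV -rmorphM /= expr0n addr0.
(* If h vanishes at z, then both sides are 0 by the convention 0^-1 = 0. *)
have [->|w0] := eqVneq w 0; last by field.
by rewrite expr0n !(mulr0, invr0).
Qed.

Lemma criticalE h z : critical h z <-> pd 0 h z ^+ 2 + pd 1 h z ^+ 2 = 0.
Proof.
rewrite /critical /= dz_hE; move: (pd 0 h z) (pd 1 h z) => u v; split.
  move/eqP; rewrite mulf_eq0 invr_eq0 pnatr_eq0 /= eq_complex /= oppr_eq0.
  by move=> /andP[/eqP -> /eqP ->]; rewrite expr0n addr0.
move=> /eqP; rewrite paddr_eq0 ?sqr_ge0 // !sqrf_eq0 => /andP[/eqP -> /eqP ->].
by rewrite oppr0 mulr0.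
Qed.

Lemma critical_g_T h z : h z != 0 -> critical h z <-> g_T h z = 0.
Proof.
move=> h0; rewrite criticalE g_TE.
move: (_ + _ ^+ 2) => N; split => [->|]; first by rewrite mul0r raddf0.
move/matrixP/(_ 0 0); rewrite !mxE eqxx mulr1n => /eqP.
rewrite mulf_eq0 invr_eq0 mulf_eq0 pnatr_eq0 /= sqrf_eq0 (negPf h0) orbF.
by move/eqP.
Qed.

(** Harmonicity of h, h_x and h_y gives the relations between derivatives that
    [liouville_identity] needs; continuity of h_x and h_y keeps N nonzero near
    a noncritical point. *)
Lemma gauss_curvature_g_T D h z : open D -> harmonic_on D h ->
  (forall y, D y -> h y != 0) -> D z -> ~ critical h z ->
  gauss_curvature (g_T h) z = - 4.
Proof.
move=> oD hh h0 Dz /criticalE/eqP N0; have [sh lap] := hh.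
have [sp lap_p] := harmonic_on_pd 0 oD hh.
have [sq lap_q] := harmonic_on_pd 1 oD hh.
have onD (P : Cx R -> Prop) : (forall y, D y -> P y) -> \forall y \near z, P y.
  by move=> DP; apply: filterS DP _; exact: open_nbhs_nbhs.
have dnear i f : smooth_on (V := Cx R) D f ->
    \forall y \near z, is_rderiv (pdir R i) f y (pd i f y).
  by move=> sf; apply: onD => y Dy; exact: smooth_on_is_pd sf Dy.
have d2 i f : smooth_on (V := Cx R) D f ->
    is_rderiv (pdir R i) (pd i f) z (pd i (pd i f) z).
  by move=> sf; exact: smooth_on_is_pd (smooth_on_pd i sf) Dz.
have nearN : \forall y \near z, pd 0 h y ^+ 2 + pd 1 h y ^+ 2 != 0.
  have cp := smooth_on_continuous sp Dz.
  have cq := smooth_on_continuous sq Dz.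
  move: (pd 0 h) (pd 1 h) cp cq N0 => p q cp cq N0.
  have Nc : {for z, continuous (fun y => p y * p y + q y * q y)}.
    by apply: continuousD; apply: continuousM.
  exact: cvgr_neq0 Nc N0.
have dlog i := is_rderiv_half_dlog (dnear i _ sh) (d2 i _ sh) (dnear i _ sp)
  (d2 i _ sp) (dnear i _ sq) (d2 i _ sq) (onD _ h0) nearN.
rewrite g_TE (gauss_curvature_conformal (dlog 0) (dlog 1)).
have qx : pd 0 (pd 1 h) z = pd 1 (pd 0 h) z by exact: pdC oD sh Dz.
exact: liouville_identity qx (lap z Dz) (lap_p z Dz) (lap_q z Dz) (h0 z Dz) N0.
Qed.
End HarmonicMetric.

(** * The curvature of the metric of the current *)

Theorem proposition2 (R : realType) (d : nat) (a : 'I_3 -> Cpoly3 R)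
  (hF : HFol d a) (T : (Cvec R 3 -> 'M[Cx R]_3) -> Cx R)
  (hT : directed_harmonic_current d a T) :
  exists2 c : R, c < 0 &
    forall (D S : set (Cx R)) (Phi : Cvec R 2 -> Cvec R 3)
      (h : Cx R -> Cx R -> R) (mu : {measure set (R * R)%type -> \bar R}),
      flow_box a D S Phi ->
      harmonic_decomposition T D S Phi h mu ->
      {ae mu, forall al : R * R, S (cx_of al) ->
        forall z : Cx R, D z ->
          (critical (h (cx_of al)) z <-> g_T (h (cx_of al)) z = 0) /\
          (~ critical (h (cx_of al)) z ->
           gauss_curvature (g_T (h (cx_of al))) z = c)}.
Proof.
exists (- 4); first by rewrite oppr_lt0.
move=> D S Phi h mu [[oD _] _ _ _ _] [hpos _ _].
apply: filterS hpos => al hal Sal z Dz; have [hh h0] := hal Sal.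
have {}h0 y : D y -> h (cx_of al) y != 0 by move=> /h0; exact: lt0r_neq0.
split; first exact: critical_g_T (h0 z Dz).
exact: gauss_curvature_g_T oD hh h0 Dz.
Qed.
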